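(* Suppose that (B) holds and $H_1$ is true with a change point $m$ satisfying $c_1\le t_m\le c_2$ for some constants $c_1,c_2\in(0,1)$. Let $\gamma\in(0,e^{-1})$ and suppose that $\log^3(np)\le Kn$ and $\log(\gamma^{-1})\le K\log(np)$ for some constant $K>0$. (i) If (C) holds, then there exists a constant $C:=C(\bar b,K,c_1,c_2)>0$ such that $$\mathbb P_1\left(|t_{\hat m_0}-t_m|\le\frac{C\log^4(np)}{n\,\underline\delta_n^2}\right)\ge1-\gamma .$$ (ii) If (D) holds for some $q\ge2$, then there exists a constant $C:=C(\bar b,K,q,c_1,c_2)>0$ such that $$\mathbb P_1\left(|t_{\hat m_0}-t_m|\le\frac{C\log(np)}{n\,\underline\delta_n^2}\max\left\{1,\frac{n^{2/q}\log(np)}{\gamma^{2/q}}\right\}\right)\ge1-\gamma .$$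
   Context: Let $n\ge 4$, $p\ge 3$. Mean-shift model: $X_i=\mu+\delta_n\mathbf 1(i>m)+\xi_i\in\mathbb R^p$, $i=1,\dots,n$, with $\mu,\delta_n\in\mathbb R^p$ and $\xi_1,\dots,\xi_n$ i.i.d. mean-zero random vectors in $\mathbb R^p$. $H_1$: $\delta_n\ne0$ and there is a change point $m\in\{1,\dots,n-1\}$. $\mathbb P_1$ denotes probability under $H_1$; $|\cdot|_\infty$ is the maximum absolute coordinate. Let $\mathcal S=\{j\in\{1,\dots,p\}:\delta_{nj}\ne0\}$ and $\underline\delta_n=\min_{j\in\mathcal S}|\delta_{nj}|$. Change point location estimator: $\hat m_0=\operatorname{argmax}_{1\le s<n}|Z_{0,n}(s)|_\infty$, where $Z_{0,n}(s)=\frac{s(n-s)}{n}\Big(\frac1s\sum_{i=1}^sX_i-\frac1{n-s}\sum_{i=s+1}^nX_i\Big)$. Normalized locations: $t_m=m/n$ and $t_{\hat m_0}=\hat m_0/n$. Conditions, for given constants $\bar b,q>0$ and all $i=1,\dots,n$, $j=1,\dots,p$: (B) $\mathbb E|\xi_{ij}|^{2+\ell}\le\bar b^\ell$ for $\ell=1,2$. (C) $\|\xi_{ij}\|_{\psi_1}\le\bar b$, where $\|X\|_{\psi_1}=\inf\{c>0:\mathbb E[\exp(|X|/c)-1]\le1\}$. (D) $\mathbb E[\max_{1\le j\le p}(|\xi_{ij}|/\bar b)^q]\le1$. *)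

(* Defs.v *)
From HB Require Import structures.
From mathcomp Require Import all_boot all_order all_algebra.
From mathcomp Require Import all_classical all_reals all_analysis.

Set Implicit Arguments.
Unset Strict Implicit.
Unset Printing Implicit Defensive.

Import Order.TTheory GRing.Theory Num.Theory.
Import numFieldNormedType.Exports.

Local Open Scope classical_set_scope.
Local Open Scope ring_scope.

(* Random vectors of R^p take values in [p.-tuple R], which carries the product
   sigma-algebra; [vec_of] moves their values to row vectors, which carry the
   vector space structure and whose norm [`|v|] is the maximum absolute
   coordinate. *)
Definition vec_of (R : realType) (p : nat) (x : p.-tuple R) : 'rV[R]_p :=
  \row_j tnth x j.

Section iid.
Context {d : measure_display} {T : measurableType d} {R : realType}.
Variable P : probability T R.

Definition mutually_independent (I : finType) (d' : measure_display)
    (E : measurableType d') (Y : I -> T -> E) : Prop :=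
  forall (J : {set I}) (B : I -> set E),
    (forall i, i \in J -> measurable (B i)) ->
    (P (\bigcap_(i in [set` J]) (Y i @^-1` B i)) =
      \prod_(i in J) P (Y i @^-1` B i))%E.

Definition identically_distributed (I : finType) (d' : measure_display)
    (E : measurableType d') (Y : I -> {RV P >-> E}) : Prop :=
  forall (i k : I) (B : set E), measurable B ->
    distribution P (Y i) B = distribution P (Y k) B.

Definition iid (I : finType) (d' : measure_display)
    (E : measurableType d') (Y : I -> {RV P >-> E}) : Prop :=
  mutually_independent (fun i => Y i : T -> E) /\ identically_distributed Y.

Definition psi1_norm (X : T -> R) : \bar R :=
  ereal_inf [set c%:E | c in
    [set c : R | 0 < c /\ ('E_P[fun w => (expR (`|X w| / c) - 1)%R] <= 1)%E]].

End iid.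

Section noise.
Context {d : measure_display} {T : measurableType d} {R : realType}.
Variables (P : probability T R) (n p : nat).
Variable xi : 'I_n -> {RV P >-> p.-tuple R}.

Definition noise_coord (i : 'I_n) (j : 'I_p) : T -> R := fun w => tnth (xi i w) j.

Definition mean_zero : Prop := forall i j,
  P.-integrable setT (EFin \o noise_coord i j) /\ ('E_P[noise_coord i j] = 0)%E.

Definition condB (b : R) : Prop := forall i j (l : nat),
  l \in [:: 1%N; 2%N] ->
  ('E_P[fun w => (`|noise_coord i j w| ^+ (2 + l))%R] <= (b ^+ l)%:E)%E.

Definition condC (b : R) : Prop := forall i j,
  (psi1_norm P (noise_coord i j) <= b%:E)%E.

Definition condD (b q : R) : Prop := forall i,
  ('E_P[fun w => (\big[Num.max/0]_(j < p) ((`|noise_coord i j w| / b) `^ q))%R] <= 1)%E.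

End noise.

Section change_point.
Context {R : realType}.
Variables n p : nat.

(* An index [i : 'I_n] stands for the observation number i + 1, so that the mean
   is shifted iff m < i + 1. *)
Definition mean_shift (T : Type) (mu delta : 'rV[R]_p) (m : nat)
    (xi : 'I_n -> T -> p.-tuple R) (w : T) (i : 'I_n) : 'rV[R]_p :=
  mu + (if (m < i.+1)%N then delta else 0) + vec_of (xi i w).

Definition cusum (x : 'I_n -> 'rV[R]_p) (s : nat) : 'rV[R]_p :=
  (s%:R * (n - s)%:R / n%:R) *:
    (s%:R^-1 *: (\sum_(i < n | (i < s)%N) x i)
     - (n - s)%:R^-1 *: (\sum_(i < n | (s <= i)%N) x i)).

(* The argmax need not be unique: [s0] is any of the maximizers. *)
Definition is_argmax_cusum (x : 'I_n -> 'rV[R]_p) (s0 : nat) : Prop :=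
  (0 < s0 < n)%N /\
  forall s : nat, (0 < s < n)%N -> `|cusum x s| <= `|cusum x s0|.

Definition shift_support (delta : 'rV[R]_p) : {set 'I_p} :=
  [set j | delta 0 j != 0]%SET.

(* The unit [`|delta|] of the minimum bounds all the terms from above, so the
   value is the minimum of the terms as soon as delta != 0. *)
Definition min_shift (delta : 'rV[R]_p) : R :=
  \big[Num.min/`|delta|]_(j in shift_support delta) `|delta 0 j|.

Definition location (s : nat) : R := s%:R / n%:R.

End change_point.

(* Main.v *)
Require Import Defs.
From HB Require Import structures.
From mathcomp Require Import all_boot all_order all_algebra.
From mathcomp Require Import all_classical all_reals all_analysis.
From mathcomp Require Import measurable_realfun measurable_fun_approximation simple_functions.
From mathcomp Require Import ring lra zify.

Set Implicit Arguments.
Unset Strict Implicit.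
Unset Printing Implicit Defensive.

Import Order.TTheory GRing.Theory Num.Theory.
Import numFieldNormedType.Exports.

Local Open Scope classical_set_scope.
Local Open Scope ring_scope.

(** The CUSUM process, taken coordinate by coordinate, is the bridge of the
    observations, B(s) = sum over i < s, minus s / n times the total sum.  The
    bridge is linear and kills constants, so each coordinate is delta_j g(s)
    plus the bridge of the noise, where g <= 0 is piecewise linear and minimal at
    the change point m: g(s) - g(m) >= c |s - m| and -g(m) >= c^2 n, where
    c = min(c1, 1 - c2).

    Suppose that every sum of the noise over k consecutive indices is at most
    sqrt k L, in every coordinate.  Then the noise bridge is O(sqrt n L)
    everywhere and its increment between m and s is O(sqrt |s - m| L).  Let s be
    a maximizer and j a coordinate that realizes the maximum.  Either the peak
    at s has the sign of the peak at m, and the loss of signal c |delta_j| |s - m|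
    must be paid by the noise increment, so that |s - m| = O(L^2 / delta_j^2); or
    the peak at s is due to noise alone, so that n |delta_j'| = O(sqrt n L) for
    some active j' and n = O(L^2 / delta_j'^2), which bounds |s - m| trivially.
    This is [argmax_cusum_location].

    It remains to find L.  For a block of k indices take the Chernoff bound with
    the single parameter 1 / (M sqrt k), where M is a scale of the noise.  If
    the moment generating function of one noise coordinate there is at most
    exp(A / k), the normalized block sum exceeds A + x with probability at most
    exp(-x), whatever k is; a union bound over the O(n^2 p) blocks, coordinates
    and signs then costs x = O(log (np)), since log (1 / gamma) <= K log (np).
    So L = O(M log (np)) ([location_error_whp]).

    Both tail conditions give such a bound through the pointwise inequality
    exp x <= 1 + x + 4 x^2 exp |x|, whose linear term integrates to zero.  Under
    (C) the scale is M = 4 b ([condC_mgf]), so L^2 = O(log^2 (np)), which is at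
    most log^4 (np) as log (np) >= 1.  Under (D) the noise is truncated at
    M = b (2 n / gamma)^(1/q), which changes nothing with probability
    1 - gamma / 2 by Markov's inequality, and the bias created by the truncation
    is absorbed by the q-th moment ([condD_mgf]). *)

(** * Expectation of products of independent variables *)

Section weight.
Local Open Scope ereal_scope.
Context d d' (T : measurableType d) (E : measurableType d') (R : realType).
Variables (P : {measure set T -> \bar R}) (X : {mfun T >-> E}) (U : T -> R).
Import HBNNSimple.

(** A nonnegative weight [U] that is uncorrelated with every event depending on
    [X] is uncorrelated with every nonnegative function of [X]: both sides are
    linear and continuous along increasing sequences in [f], so simple functions
    suffice. *)
Lemma ge0_integral_weight (c : R) (f : E -> R) :
  measurable_fun setT U -> (forall w, 0 <= U w)%R ->
  (forall B, measurable B ->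
    \int[P]_w (U w * \1_B (X w))%:E = c%:E * P (X @^-1` B)) ->
  measurable_fun setT f -> (forall x, 0 <= f x)%R ->
  \int[P]_w (U w * f (X w))%:E = c%:E * \int[P]_w (f (X w))%:E.
Proof.
move=> mU U0 XU mf f0.
have simpleE (h : {nnsfun E >-> R}) :
    \int[P]_w (U w * h (X w))%:E = c%:E * \int[P]_w (h (X w))%:E.
  have mind (y : R) : measurable_fun setT (fun w => (\1_(h @^-1` [set y]) (X w) : R)).
    by apply: measurableT_comp => //.
  have ind0 (y : R) w : (0 <= (y * \1_(h @^-1` [set y]) (X w))%:E).
    by have := nnfun_muleindic_ge0 h y (X w).
  transitivity (\int[P]_w (\sum_(y \in range h)
      (y * (U w * \1_(h @^-1` [set y]) (X w)))%:E)).
    apply: eq_integral => w _; rewrite fimfunE fsumEFin//; congr EFin.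
    by rewrite mulr_fsumr; apply: eq_fsbigr => y _; rewrite mulrCA.
  rewrite ge0_integral_fsum//; last 2 first.
  - move=> y; apply/measurable_EFinP; apply: measurable_funM => //.
    exact: measurable_funM.
  - by move=> y w _; rewrite mulrCA lee_fin mulr_ge0// -lee_fin.
  transitivity (\sum_(y \in range h) c%:E * \int[P]_w (y * \1_(h @^-1` [set y]) (X w))%:E).
    apply: eq_fsbigr => y /[!inE] -[x _ <-].
    under eq_integral do rewrite EFinM.
    rewrite ge0_integralZl_EFin//; last 2 first.
    - by move=> w _; rewrite lee_fin mulr_ge0.
    - by apply/measurable_EFinP; exact: measurable_funM.
    under [in RHS]eq_integral do rewrite EFinM.
    rewrite ge0_integralZl_EFin//; last by apply/measurable_EFinP.
    rewrite XU// muleCA; congr (_ * (_ * _)).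
    have -> : (fun w => (\1_(h @^-1` [set h x]) (X w))%:E) =
      (fun w => (\1_(X @^-1` (h @^-1` [set h x])) w)%:E :> \bar R).
      by apply/funext => w; rewrite !indicE.
    rewrite integral_indic ?setIT//.
    by rewrite -[X in measurable X]setTI; exact: measurable_funP.
  rewrite -ge0_mule_fsumr; last first.
    by move=> y; apply: integral_ge0.
  congr (_ * _).
  rewrite -ge0_integral_fsum//; last first.
    by move=> y; apply/measurable_EFinP; apply: measurable_funM.
  by apply: eq_integral => w _; rewrite [in RHS]fimfunE fsumEFin.
have mEf : measurable_fun setT (EFin \o f) by exact/measurable_EFinP.
pose h := nnsfun_approx measurableT mEf.
have hcvg x : (h n x)%:E @[n --> \oo] --> (f x)%:E.
  by apply: (cvg_nnsfun_approx measurableT mEf) => // y _; rewrite lee_fin.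
have hnd x : {homo h ^~ x : a b / (a <= b)%N >-> (a <= b)%R}.
  by move=> a b ab; exact/lefP/nd_nnsfun_approx.
have mhX n : measurable_fun setT (fun w => h n (X w)) by exact: measurableT_comp.
have -> : \int[P]_w (f (X w))%:E = limn (fun n => \int[P]_w (h n (X w))%:E).
  rewrite -monotone_convergence//.
  - by apply: eq_integral => w _; apply/esym/cvg_lim => //; exact: hcvg.
  - by move=> n; exact/measurable_EFinP.
  - by move=> n w _; rewrite lee_fin.
  - by move=> w _ a b ab; rewrite lee_fin hnd.
rewrite -limeMl//; last first.
  apply/ereal_nondecreasing_is_cvgn => a b ab; apply: ge0_le_integral => //.
  - by move=> w _; rewrite lee_fin.
  - exact/measurable_EFinP.
  - exact/measurable_EFinP.
  - by move=> w _; rewrite lee_fin hnd.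
transitivity (limn (fun n => \int[P]_w (U w * h n (X w))%:E)).
  rewrite -monotone_convergence//.
  - apply: eq_integral => w _; apply/esym/cvg_lim => //.
    under eq_fun do rewrite EFinM.
    by rewrite EFinM; apply: cvgeZl => //; exact: hcvg.
  - by move=> n; apply/measurable_EFinP; exact: measurable_funM.
  - by move=> n w _; rewrite lee_fin mulr_ge0.
  - by move=> w _ a b ab; rewrite lee_fin ler_wpM2l// hnd.
by congr (limn _); apply/funext => n; exact: simpleE.
Qed.
End weight.

Section independence.
Local Open Scope ereal_scope.
Context d d' (T : measurableType d) (E : measurableType d') (R : realType).
Variables (P : probability T R) (I : finType) (Y : I -> {mfun T >-> E}).
Hypothesis indepY : mutually_independent P (fun i => Y i : T -> E).

(** Independence is the case in which all the factors are indicators.  The factors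
    are turned into arbitrary functions one at a time, the product of the others
    serving as the weight in [ge0_integral_weight]. *)
Lemma integral_prod_indep (J : {set I}) (f : I -> E -> R) (e : I -> R) :
  (forall i, measurable_fun setT (f i)) -> (forall i x, 0 <= f i x)%R ->
  (forall i, i \in J -> \int[P]_w (f i (Y i w))%:E = (e i)%:E) ->
  \int[P]_w (\prod_(i in J) f i (Y i w))%:E = (\prod_(i in J) e i)%:E.
Proof.
(* [D] collects the factors that are arbitrary, the other ones are indicators. *)
suff gen n (D : {set I}) (B : I -> set E) (g : I -> E -> R) (c : I -> R) :
    #|D| = n -> D \subset J -> (forall i, measurable (B i)) ->
    (forall i, i \in J :\: D -> g i = \1_(B i)) ->
    (forall i, measurable_fun setT (g i)) -> (forall i x, 0 <= g i x)%R ->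
    (forall i, i \in J -> \int[P]_w (g i (Y i w))%:E = (c i)%:E) ->
    \int[P]_w (\prod_(i in J) g i (Y i w))%:E = (\prod_(i in J) c i)%:E.
  move=> mf f0 fe; apply: (gen #|J| J (fun=> setT)) => // i.
  by rewrite !inE; case: (i \in J).
have PE A : measurable A -> \int[P]_w (\1_A w)%:E = P A.
  by move=> mA; rewrite integral_indic ?setIT.
elim: n D B g c => [|n IH] D B g c cardD DJ mB gB mg g0 gc.
  move/eqP: cardD; rewrite cards_eq0 => /eqP D0; subst D.
  have {}gB i : i \in J -> g i = \1_(B i) by move=> iJ; apply: gB; rewrite !inE.
  have mYB i : measurable (Y i @^-1` B i).
    by rewrite -[X in measurable X]setTI; exact: measurable_funP.
  have PB i : i \in J -> P (Y i @^-1` B i) = (c i)%:E.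
    move=> iJ; rewrite -gc// gB//.
    by rewrite -PE.
  rewrite -prodEFin -(eq_bigr _ PB) -indepY//.
  rewrite -PE; last first.
    by apply: fin_bigcap_measurable => [|i _ ]; [exact: finite_finset|exact: mYB].
  apply: eq_integral => w _; congr EFin.
  under eq_bigr => i iJ do rewrite gB//.
  rewrite indicE; have [/set_mem wB|/negP wB] := boolP (w \in _).
    by rewrite big1// => i iJ; rewrite indicE mem_set//; exact: (wB i).
  have /existsNP[i /not_implyP[/= iJ wBi]] := contra_not (@mem_set _ _ _) wB.
  by rewrite (bigD1 i)//= indicE memNset ?mul0r//.
have [k kD] : exists k, k \in D.
  by apply/set0Pn; rewrite -cards_eq0 cardD.
have kJ : k \in J by apply: (fintype.subsetP DJ).
rewrite (big_setD1 k)//= mulrC EFinM.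
under eq_integral do rewrite (big_setD1 k)//= mulrC.
rewrite (@ge0_integral_weight _ _ _ _ _ P (Y k)
  (fun w => \prod_(i in J :\ k) g i (Y i w))%R (\prod_(i in J :\ k) c i)%R); last 2 first.
- exact: mg.
- exact: g0.
- by rewrite gc.
- under eq_fun do rewrite -big_filter.
  by apply: measurable_prod => i _; exact: measurableT_comp.
- by move=> w; apply: prodr_ge0.
move=> A mA.
(* Testing against an event of [Y k] makes the factor [k] an indicator. *)
pose g' i := if i == k then \1_A else g i.
pose c' i := if i == k then fine (P (Y k @^-1` A)) else c i.
have mYA : measurable (Y k @^-1` A).
  by rewrite -[X in measurable X]setTI; exact: measurable_funP.
have g'E w : (\prod_(i in J :\ k) g i (Y i w) * \1_A (Y k w) =
    \prod_(i in J) g' i (Y i w))%R.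
  rewrite [RHS](big_setD1 k)//= [RHS]mulrC {2}/g' eqxx; congr (_ * _)%R.
  by apply: eq_bigr => i; rewrite !inE /g' => /andP[/negbTE ->].
under eq_integral do rewrite g'E.
rewrite (IH (D :\ k) (fun i => if i == k then A else B i) g' c').
- rewrite (big_setD1 k)//= {1}/c' eqxx mulrC EFinM fineK ?fin_num_measure//.
  congr ((EFin _) * _).
  by apply: eq_bigr => i; rewrite !inE /c' => /andP[/negbTE ->].
- by move: cardD; rewrite (cardsD1 k) kD => -[].
- exact: (fintype.subset_trans (subsetDl _ _) DJ).
- by move=> i; case: ifP.
- move=> i; rewrite !inE /g'; case: eqP => //= ik /andP[iD iJ].
  by apply: gB; rewrite !inE iD.
- by move=> i; rewrite /g'; case: ifP.
- by move=> i x; rewrite /g'; case: ifP.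
- move=> i iJ; rewrite /g' /c'; case: eqP => [->|_]; last exact: gc.
  by rewrite fineK ?fin_num_measure// -PE.
Qed.
End independence.

(** * Tail bounds *)

Section tail_bounds.
Local Open Scope ereal_scope.
Context d (T : measurableType d) (R : realType) (P : probability T R).

Lemma markov_ge0 (g : T -> R) (c s : R) :
  measurable_fun setT g -> (forall w, 0 <= g w)%R ->
  \int[P]_w (g w)%:E <= c%:E -> (0 < s)%R ->
  P [set w | (s <= g w)%R] <= (c / s)%:E.
Proof.
move=> mg g0 gc s0.
have mA : measurable [set w | (s <= g w)%R].
  rewrite -[X in measurable X]setTI.
  by apply: (measurable_fun_le (D := setT)) => //; exact: measurable_cst.
rewrite EFinM lee_pdivlMr// muleC.
apply: le_trans gc.
have -> : s%:E * P [set w | (s <= g w)%R] =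
    \int[P]_w (s * \1_[set w | (s <= g w)%R] w)%:E.
  under eq_integral do rewrite EFinM.
  rewrite ge0_integralZl_EFin ?integral_indic ?setIT ?ltW//.
  by apply/measurable_EFinP; exact: measurable_indic.
apply: ge0_le_integral => //.
- by move=> w _; rewrite lee_fin mulr_ge0// ltW.
- by apply/measurable_EFinP; apply: measurable_funM => //; exact: measurable_indic.
- exact/measurable_EFinP.
- move=> w _; rewrite lee_fin indicE; have [/set_mem|_] := boolP (w \in _).
    by rewrite mulr1.
  by rewrite mulr0.
Qed.

Lemma chernoff_indep_sum d' (E : measurableType d') (I : finType)
    (Y : I -> {mfun T >-> E}) (J : {set I}) (f : I -> E -> R) (a t : R) :
  mutually_independent P (fun i => Y i : T -> E) ->
  (forall i, measurable_fun setT (f i)) ->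
  (forall i, i \in J -> \int[P]_w (expR (f i (Y i w)))%:E <= (expR a)%:E) ->
  P [set w | (t <= \sum_(i in J) f i (Y i w))%R] <= (expR (a *+ #|J| - t))%:E.
Proof.
move=> indepY mf fa.
have -> : [set w | (t <= \sum_(i in J) f i (Y i w))%R] =
    [set w | (expR t <= \prod_(i in J) expR (f i (Y i w)))%R].
  by apply/seteqP; split => w /=; rewrite -expR_sum ler_expR.
rewrite expRD expRN; apply: markov_ge0; last exact: expR_gt0.
- under eq_fun do rewrite -big_filter.
  apply: measurable_prod => i _; apply: measurableT_comp => //.
  exact: measurableT_comp.
- by move=> w; apply: prodr_ge0 => i _; exact: expR_ge0.
pose e i := fine (\int[P]_w (expR (f i (Y i w)))%:E).
have e0 i : (0 <= \int[P]_w (expR (f i (Y i w)))%:E).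
  by apply: integral_ge0 => w _; rewrite lee_fin expR_ge0.
have eE i : i \in J -> \int[P]_w (expR (f i (Y i w)))%:E = (e i)%:E.
  move=> iJ; rewrite fineK// ge0_fin_numE//.
  by rewrite (le_lt_trans (fa _ iJ))// ltry.
rewrite (@integral_prod_indep _ _ _ _ _ P I Y indepY J (fun i x => expR (f i x)) e)//.
- rewrite lee_fin -mulr_natl expRM_natl -prodr_const.
  by apply: ler_prod => i iJ; rewrite -!lee_fin -eE// e0/= fa.
- by move=> i; exact: measurableT_comp.
Qed.

Lemma union_bound (F : finType) (B : F -> set T) (c : R) :
  (forall k, measurable (B k)) -> (forall k, P (B k) <= c%:E) ->
  P (\bigcup_k B k) <= (c *+ #|F|)%:E.
Proof.
move=> mB PB.
suff bnd (s : seq F) : P (\big[setU/set0]_(k <- s) B k) <= (c *+ size s)%:E.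
  have -> : \bigcup_k B k = \big[setU/set0]_(k <- enum F) B k.
    rewrite -bigcup_seq; congr (\bigcup_(k in _) B k); apply/esym.
    by apply/seteqP; split => // k _ /=; rewrite mem_enum.
  by rewrite cardE; exact: bnd.
elim: s => [|k s IH]; first by rewrite big_nil measure0.
have mU (r : seq F) : measurable (\big[setU/set0]_(k <- r) B k).
  by apply: bigsetU_measurable => i _; exact: mB.
rewrite big_cons (le_trans (measureU2 _ (mB k) (mU s)))//.
by rewrite /= mulrS EFinD; exact: leeD.
Qed.

End tail_bounds.

(** * Simultaneous concentration of partial sums *)

Section moment_generating_function.
Context d (T : measurableType d) (R : realType) (P : probability T R).

(** For [x <= 1 / 2] the bound follows from [expR x <= 1 / (1 - x)]; for larger [x]
    the quadratic term alone is at least [expR x]. *)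
Lemma expR_le_quadratic (x : R) :
  expR x <= 1 + x + 4 * x ^+ 2 * expR `|x|.
Proof.
have E1 : 1 <= expR `|x| by rewrite -expR0 ler_expR.
have [xle|xgt] := leP x (1 / 2).
  have : (1 - x) * expR x <= 1.
    have := expR_ge1Dx (- x); rewrite -(ler_pM2r (expR_gt0 x)).
    by rewrite -expRD addNr expR0.
  have x2 : 0 <= x ^+ 2 by exact: sqr_ge0.
  have xx : 0 <= x ^+ 2 * (1 / 2 - x) by apply: mulr_ge0 => //; lra.
  have Ex : 0 <= x ^+ 2 * (expR `|x| - 1) by apply: mulr_ge0 => //; lra.
  move=> h.
  have : (1 - x) * expR x <= (1 - x) * (1 + x + 4 * x ^+ 2) by nra.
  rewrite ler_pM2l; last by lra.
  nra.
have -> : `|x| = x by rewrite ger0_norm//; lra.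
have := expR_gt0 x.
have : 1 <= 4 * x ^+ 2 by nra.
nra.
Qed.

(** [U] stands for an exponential of a variable that may differ from [lam * X], for
    instance by truncation; the difference is charged to [H]. *)
Lemma mgf_le (X H U : T -> R) (lam a h : R) :
  P.-integrable setT (EFin \o X) -> (\int[P]_w (X w)%:E = 0)%E ->
  measurable_fun setT H -> (forall w, 0 <= H w) ->
  (\int[P]_w (H w)%:E <= h%:E)%E ->
  measurable_fun setT U -> (forall w, 0 <= U w) -> 0 <= a ->
  (forall w, U w <= 1 + lam * X w + a * H w) ->
  (\int[P]_w (U w)%:E <= (expR (a * h))%:E)%E.
Proof.
move=> iX X0 mH H0 Hh mU U0 a0 UXH.
have iH : P.-integrable setT (EFin \o H).
  apply/integrableP; split; first exact/measurable_EFinP.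
  under eq_integral do rewrite gee0_abs ?lee_fin//.
  by rewrite (le_lt_trans Hh)// ltry.
have i1 : P.-integrable setT (fun=> 1%E : \bar R).
  exact: finite_measure_integrable_cst.
have ilX : P.-integrable setT (fun w => lam%:E * (X w)%:E)%E.
  exact: integrableZl.
have iaH : P.-integrable setT (fun w => a%:E * (H w)%:E)%E.
  exact: integrableZl.
have i1X := integrableD measurableT i1 ilX.
apply: (@le_trans _ _ (\int[P]_w (1 + lam%:E * (X w)%:E + a%:E * (H w)%:E))%E).
  apply: ge0_le_integral => //.
  - by move=> w _; rewrite lee_fin.
  - exact/measurable_EFinP.
  - by apply: (measurable_int P); exact: integrableD.
  - by move=> w _; rewrite lee_fin UXH.
rewrite integralD// integralD// !integralZl// X0 mule0 adde0.
have -> : (\int[P]_w (1 : \bar R) = 1)%E.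
  by rewrite integral_cst// mul1e; exact: probability_setT.
apply: (@le_trans _ _ (1 + a * h)%:E); last by rewrite lee_fin expR_ge1Dx.
by rewrite EFinD EFinM leeD2l// lee_wpmul2l.
Qed.

(** The exponent [1 / (M * sqrt k)] is adapted to the size [k] of the index set,
    so that the product of the [k] generating functions is at most [expR A] for all
    sizes at once.
    The Chernoff bound is applied to the noise transformed by [tr], which is the
    noise itself outside of the event [bad]. *)
Lemma concentration_index_sets (n p : nat) (xi : 'I_n -> {RV P >-> p.-tuple R})
    (F : finType) (J : F -> {set 'I_n}) (tr : R -> R) (M A t beta : R)
    (bad : set T) :
  mutually_independent P (fun i => xi i : T -> p.-tuple R) ->
  measurable_fun setT tr -> 0 < M -> 0 <= A ->
  (forall (i : 'I_n) (j : 'I_p) (eps : bool) (k : nat), (0 < k <= n)%N ->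
    (\int[P]_w (expR ((-1) ^+ eps * tr (noise_coord xi i j w) / (M * Num.sqrt k%:R)))%:E
     <= (expR (A / k%:R))%:E)%E) ->
  measurable bad -> (P bad <= beta%:E)%E ->
  (forall w, ~ bad w -> forall i j, tr (noise_coord xi i j w) = noise_coord xi i j w) ->
  exists G : set T, [/\ measurable G,
    (P (~` G) <= (beta + expR (A - t) *+ (#|F| * p * 2))%:E)%E &
    forall w, G w -> forall k j,
      `|\sum_(i in J k) noise_coord xi i j w| <= M * Num.sqrt #|J k|%:R * t].
Proof.
move=> indep mtr M0 A0 mgf mbad Pbad trE.
pose f (x : F * 'I_p * bool) (i : 'I_n) (v : p.-tuple R) : R :=
  (-1) ^+ x.2 * tr (tnth v x.1.2) / (M * Num.sqrt #|J x.1.1|%:R).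
have mf x i : measurable_fun setT (f x i).
  apply: measurable_funM => //; apply: measurable_funM => //.
  by apply: measurableT_comp => //; exact: measurable_tnth.
pose B x := [set w | t <= \sum_(i in J x.1.1) f x i (xi i w)].
have mB x : measurable (B x).
  rewrite -[X in measurable X]setTI; apply: measurable_fun_le => //.
  under eq_fun do rewrite -big_filter.
  by apply: measurable_sum => i; exact: measurableT_comp.
have PB x : (P (B x) <= (expR (A - t))%:E)%E.
  apply: le_trans (@chernoff_indep_sum _ _ _ P _ _ _ xi (J x.1.1) (f x)
    (A / #|J x.1.1|%:R) t indep (mf x) _) _.
    move=> i iJ; apply: mgf; apply/andP; split.
      by apply/card_gt0P; exists i.
    by rewrite -[leqRHS](card_ord n) max_card.
  rewrite lee_fin ler_expR lerD2r.
  have [->|k0] := eqVneq #|J x.1.1| 0%N; first by rewrite mulr0n.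
  by rewrite -[_ *+ _]mulr_natr divfK// pnatr_eq0.
have mU : measurable (\bigcup_x B x).
  by apply: fin_bigcup_measurable => //; exact: finite_finset.
exists (~` (bad `|` \bigcup_x B x)); split.
- by apply: measurableC; exact: measurableU.
- rewrite setCK (le_trans (measureU2 _ mbad mU))// EFinD leeD//.
  by have := union_bound mB PB; rewrite !card_prod card_ord card_bool.
move=> w /= /not_orP[nbad nB] k j.
have [J0|k0] := eqVneq #|J k| 0%N.
  move/eqP: (J0); rewrite cards_eq0 => /eqP ->.
  by rewrite big_set0 normr0 cards0 sqrtr0 mulr0 mul0r.
have s0 : 0 < M * Num.sqrt #|J k|%:R.
  by rewrite mulr_gt0// sqrtr_gt0 ltr0n lt0n.
have sgn (eps : bool) :
    (-1) ^+ eps * (\sum_(i in J k) noise_coord xi i j w) <= M * Num.sqrt #|J k|%:R * t.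
  have trEw i : tr (tnth (xi i w) j) = noise_coord xi i j w := trE w nbad i j.
  have : ~ B (k, j, eps) w by move=> Bw; apply: nB; exists (k, j, eps).
  rewrite /B /f /= => /negP; rewrite -ltNge => /ltW.
  rewrite -mulr_suml -mulr_sumr ler_pdivrMr// [t * _]mulrC.
  by rewrite (eq_bigr _ (fun i _ => trEw i)).
rewrite ler_norml; have := sgn false; have := sgn true.
rewrite expr0 expr1; lra.
Qed.

End moment_generating_function.

(** * The maximizer of the CUSUM process *)

Section localization.
Context {R : realType} {n p : nat}.

Definition index_interval (ab : 'I_n.+1 * 'I_n.+1) : {set 'I_n} :=
  [set i : 'I_n | (ab.1 <= i < ab.2)%N]%SET.

Lemma card_interval (a b : nat) : (b <= n)%N ->
  #|[set i : 'I_n | (a <= i < b)%N]%SET| = (b - a)%N.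
Proof.
move=> bn; rewrite cardsE -sum1_card.
rewrite -(big_mkord (fun i => a <= i < b)%N (fun=> 1%N)).
rewrite -[RHS]muln1 -sum_nat_const_nat.
rewrite (big_nat_widen _ _ _ _ _ bn) (big_nat_widenl _ _ _ _ _ (leq0n a)).
by apply: eq_bigl => i; rewrite andbC.
Qed.

Lemma sum_interval_split (f : 'I_n -> R) (a b : nat) : (a <= b)%N ->
  \sum_(i < n | (i < b)%N) f i =
  \sum_(i < n | (i < a)%N) f i + \sum_(i in [set i : 'I_n | (a <= i < b)%N]%SET) f i.
Proof.
move=> ab; rewrite (bigID (fun i : 'I_n => (i < a)%N))/=; congr (_ + _).
  by apply: eq_bigl => i; lia.
by apply: eq_bigl => i; rewrite inE; lia.
Qed.

(** A discrete bridge: it vanishes at [0] and [n]. *)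
Definition bridge (f : 'I_n -> R) (s : nat) : R :=
  \sum_(i < n | (i < s)%N) f i - s%:R / n%:R * \sum_(i < n) f i.

Lemma cusum_bridge (x : 'I_n -> 'rV[R]_p) (s : nat) (j : 'I_p) : (0 < s < n)%N ->
  cusum x s 0 j = bridge (fun i => x i 0 j) s.
Proof.
move=> /andP[s0 sn]; rewrite /cusum /bridge !mxE !summxE.
have -> : \sum_(i < n) x i 0 j = \sum_(i < n | (i < s)%N) x i 0 j +
    \sum_(i < n | (s <= i)%N) x i 0 j.
  rewrite (bigID (fun i : 'I_n => (i < s)%N))/=; congr (_ + _).
  by apply: eq_bigl => i; lia.
rewrite natrB 1?ltnW//.
have : s%:R != 0 :> R by rewrite pnatr_eq0; lia.
have : n%:R != 0 :> R by rewrite pnatr_eq0; lia.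
have : n%:R - s%:R != 0 :> R by rewrite subr_eq0 eqr_nat; lia.
by move=> ? ? ?; field; apply/and3P.
Qed.

Lemma bridge_signal (del : R) (m s : nat) : (m <= n)%N -> (s <= n)%N ->
  bridge (fun i => if (m < i.+1)%N then del else 0) s =
  del * ((s - m)%N%:R - s%:R * (n - m)%N%:R / n%:R).
Proof.
have sumE b : (b <= n)%N ->
    \sum_(i < n | (i < b)%N) (if (m < i.+1)%N then del else 0) = del * (b - m)%N%:R.
  move=> bn; rewrite -big_mkcondr -(card_interval _ bn) mulr_natr -sumr_const.
  by apply: eq_bigl => i; rewrite inE ltnS andbC.
move=> mn sn; rewrite /bridge sumE//.
have -> : \sum_(i < n) (if (m < i.+1)%N then del else 0) = del * (n - m)%N%:R.
  by rewrite -sumE//; apply: eq_bigl => i; rewrite ltn_ord.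
by ring.
Qed.

Lemma bridgeD (f g : 'I_n -> R) s :
  bridge (fun i => f i + g i) s = bridge f s + bridge g s.
Proof. by rewrite /bridge !big_split/=; ring. Qed.

Lemma bridge_cst (u : R) s : (s <= n)%N -> bridge (fun=> u) s = 0.
Proof.
move=> sn; have [n0|n0] := posnP n.
  have -> : s = 0%N by lia.
  by rewrite /bridge mul0r mul0r subr0 big_pred0.
rewrite /bridge.
have -> : \sum_(i < n | (i < s)%N) u = u *+ s.
  by rewrite sumr_const -[in RHS](subn0 s) -(card_interval 0 sn) cardsE.
rewrite sumr_const card_ord -(mulr_natr u n) -(mulr_natr u s).
by field; rewrite pnatr_eq0; lia.
Qed.

(** The drift term of the bridge contributes [(k / n) * sqrt n * L] over [k] steps,
    which is at most [sqrt k * L] because [k <= n]. *)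
Lemma bridge_increment (e : 'I_n -> R) (L : R) (a b : nat) :
  (forall a b, (a <= b <= n)%N ->
     `|\sum_(i in [set i : 'I_n | (a <= i < b)%N]%SET) e i|
       <= Num.sqrt (b - a)%N%:R * L) ->
  (a <= b <= n)%N -> `|bridge e b - bridge e a| <= 2 * (Num.sqrt (b - a)%N%:R * L).
Proof.
move=> He /andP[ab bn].
have -> : bridge e b - bridge e a =
    \sum_(i in [set i : 'I_n | (a <= i < b)%N]%SET) e i
    - (b - a)%N%:R / n%:R * \sum_(i in [set i : 'I_n | (0 <= i < n)%N]%SET) e i.
  have -> : \sum_(i in [set i : 'I_n | (0 <= i < n)%N]%SET) e i = \sum_i e i.
    by apply: eq_bigl => i; rewrite inE ltn_ord.
  by rewrite /bridge (sum_interval_split _ ab) natrB//; ring.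
have [k0|k0] := eqVneq (b - a)%N 0%N.
  have := He a b; rewrite ab bn k0 sqrtr0 mul0r normr_le0 => /(_ isT) /eqP ->.
  by rewrite !mul0r mulr0 subr0 normr0.
have n0 : 0 < n%:R :> R by rewrite ltr0n; lia.
rewrite (le_trans (ler_normB _ _))// [leRHS]mulr_natl mulr2n lerD//.
  by apply: He; rewrite ab.
rewrite normrM [X in X * _]ger0_norm ?divr_ge0//.
set k := (b - a)%N; set sk := Num.sqrt k%:R; pose sn := Num.sqrt (n%:R : R).
have sk0 : 0 <= sk by exact: sqrtr_ge0.
have sn0 : 0 < sn by rewrite sqrtr_gt0.
have skE : k%:R = sk ^+ 2 :> R by rewrite sqr_sqrtr.
have snE : n%:R = sn ^+ 2 :> R by rewrite sqr_sqrtr// ltW.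
have skn : sk <= sn by rewrite ler_wsqrtr// ler_nat /k; lia.
have := He 0%N n; rewrite leq0n leqnn subn0 => /(_ isT) Hn.
have L0 : 0 <= L.
  by have := le_trans (normr_ge0 _) Hn; rewrite pmulr_rge0.
apply: (@le_trans _ _ (k%:R / n%:R * (sn * L))).
  by rewrite ler_wpM2l// divr_ge0.
rewrite mulrA ler_wpM2r// skE snE.
have -> : sk ^+ 2 / sn ^+ 2 * sn = sk * (sk / sn) by field; exact: lt0r_neq0.
by rewrite ler_piMr// ler_pdivrMr// mul1r.
Qed.

Lemma row_norm_attained (v : 'rV[R]_p) : (0 < p)%N -> exists j, `|v| = `|v 0 j|.
Proof.
move=> p0; have [v0|v0] := eqVneq `|v| 0.
  exists (Ordinal p0); rewrite v0; move/eqP: v0; rewrite normr_eq0 => /eqP ->.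
  by rewrite mxE normr0.
have [[i j] /= vij] := mx_norm_neq0 v0.
by exists j; rewrite -(ord1 i).
Qed.

Lemma coord_le_norm (v : 'rV[R]_p) j : `|v 0 j| <= `|v|.
Proof.
rewrite [leRHS]mx_normrE.
exact: (@le_bigmax _ _ _ 0 (fun ij : 'I_1 * 'I_p => `|v ij.1 ij.2|) (0, j)).
Qed.

Lemma min_shift_gt0 (delta : 'rV[R]_p) : delta != 0 -> 0 < min_shift delta.
Proof.
move=> d0; rewrite /min_shift; elim/big_ind: _ => [|x y x0 y0|j].
- by rewrite normr_gt0.
- by rewrite lt_min x0.
- by rewrite inE normr_gt0.
Qed.

Lemma min_shift_le (delta : 'rV[R]_p) j : delta 0 j != 0 ->
  min_shift delta <= `|delta 0 j|.
Proof.
move=> dj; rewrite /min_shift; apply: bigmin_le_cond.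
by rewrite inE.
Qed.

(** If the two values [del * g + w] have the same sign, the signal lost between
    them is paid by the increment of the noise; otherwise the noise has to reverse
    the sign of the signal. *)
Lemma argmax_dichotomy (del gm gs wm ws : R) :
  gm <= gs -> gs <= 0 -> `|del * gm + wm| <= `|del * gs + ws| ->
  `|del| * (gs - gm) <= `|ws - wm| \/ `|del| * - gm <= `|ws| + `|wm|.
Proof.
wlog del0 : del wm ws / 0 <= del => [hw|].
  have [d0|d0] := leP 0 del; first exact: hw.
  move=> gmgs gs0 h.
  have := hw (- del) (- wm) (- ws).
  have -> : - ws - - wm = - (ws - wm) by ring.
  by rewrite !mulNr -!opprD !normrN; apply=> //; rewrite oppr_ge0 ltW.
move=> gmgs gs0; rewrite (ger0_norm del0).
have h1 : del * gm <= del * gs by rewrite ler_wpM2l.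
have h2 : 0 <= del * - gs by rewrite mulr_ge0// oppr_ge0.
have := ler_norm (- (del * gm + wm)); rewrite normrN => hm.
have := ler_norm (wm - ws); rewrite distrC => hd.
have hws := ler_norm ws; have hwm := ler_norm wm.
have [z0|z0] := ger0P (del * gs + ws) => hz.
  by right; move: hm hwm hws h1 h2; rewrite !mulrN; lra.
by left; move: hm hd; rewrite mulrBr; lra.
Qed.

(** The constant [16 / c ^+ 4] comes from the case where noise beats signal, that
    is [c ^+ 2 * n * min_shift <= 4 * sqrt n * L]; the other case gives
    [4 / c ^+ 2]. *)
Lemma argmax_cusum_location (mu delta : 'rV[R]_p) (e x : 'I_n -> 'rV[R]_p)
    (m s : nat) (c L : R) :
  (0 < p)%N -> delta != 0 -> 0 < c <= 1 -> (0 < m < n)%N ->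
  c * n%:R <= m%:R -> c * n%:R <= (n - m)%N%:R ->
  (forall i, x i = mu + (if (m < i.+1)%N then delta else 0) + e i) ->
  (forall j a b, (a <= b <= n)%N ->
     `|\sum_(i in [set i : 'I_n | (a <= i < b)%N]%SET) e i 0 j|
       <= Num.sqrt (b - a)%N%:R * L) ->
  is_argmax_cusum x s ->
  `|location n s - location n m : R|
    <= 16 / c ^+ 4 * L ^+ 2 / (n%:R * min_shift delta ^+ 2).
Proof.
move=> p0 d0 /andP[c0 c1] mn cm cnm xE He [sn smax].
have [mlen slen] : (m <= n)%N /\ (s <= n)%N by lia.
have [msn smn] : (m - s <= n)%N /\ (s - m <= n)%N by lia.
have n0 : 0 < n%:R :> R by rewrite ltr0n; lia.
have nn0 : n%:R != 0 :> R by exact: lt0r_neq0.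
pose g s : R := (s - m)%N%:R - s%:R * (n - m)%N%:R / n%:R.
have zE j t : (0 < t < n)%N ->
    cusum x t 0 j = delta 0 j * g t + bridge (fun i => e i 0 j) t.
  move=> tn; rewrite cusum_bridge//.
  have -> : (fun i => x i 0 j) = (fun i => (mu 0 j +
      (if (m < i.+1)%N then delta 0 j else 0)) + e i 0 j).
    by apply/funext => i; rewrite xE !mxE; case: ifP; rewrite ?mxE.
  by rewrite bridgeD bridgeD bridge_cst ?bridge_signal ?add0r//; lia.
have L0 : 0 <= L.
  have := He (Ordinal p0) 0%N n; rewrite leq0n leqnn subn0 => /(_ isT) h.
  by have := le_trans (normr_ge0 _) h; rewrite pmulr_rge0// sqrtr_gt0.
have W_le j t : (t <= n)%N ->
    `|bridge (fun i => e i 0 j) t| <= 2 * (Num.sqrt n%:R * L).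
  move=> tn.
  have b0 : bridge (fun i => e i 0 j) 0 = 0.
    by rewrite /bridge big_pred0// !mul0r subr0.
  rewrite -[X in `|X|]subr0 -b0.
  apply: le_trans (bridge_increment (He j) _) _; first by rewrite leq0n.
  by rewrite ler_wpM2l// ler_wpM2r// ler_wsqrtr// ler_nat; lia.
pose k : R := `|s%:R - m%:R|.
have kE_le : (s <= m)%N -> k = (m - s)%N%:R.
  by move=> sm; rewrite /k distrC natrB// ger0_norm// subr_ge0 ler_nat.
have kE_ge : (m <= s)%N -> k = (s - m)%N%:R.
  by move=> ms; rewrite /k natrB// ger0_norm// subr_ge0 ler_nat.
have W_incr j : `|bridge (fun i => e i 0 j) s - bridge (fun i => e i 0 j) m|
    <= 2 * (Num.sqrt k * L).
  have [sm|ms] := leqP s m.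
    rewrite distrC (kE_le sm); apply: bridge_increment (He j) _; lia.
  rewrite (kE_ge (ltnW ms)); apply: bridge_increment (He j) _; lia.
have gm : g m = - (m%:R * (n - m)%N%:R / n%:R) by rewrite /g subnn sub0r.
have gm_le : c ^+ 2 * n%:R <= - g m.
  rewrite gm opprK ler_pdivlMr//.
  have -> : c ^+ 2 * n%:R * n%:R = (c * n%:R) * (c * n%:R) by ring.
  by apply: ler_pM => //; rewrite mulr_ge0// ltW.
have gs_le0 : g s <= 0.
  rewrite /g subr_le0; have [sm|ms] := leqP s m.
    by rewrite (eqP (_ : s - m == 0)%N) ?subn_eq0 ?divr_ge0 ?mulr_ge0.
  by rewrite ler_pdivlMr// -!natrM ler_nat; clear -slen mlen; nia.
have g_incr : c * k <= g s - g m.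
  rewrite gm opprK /g; have [sm|ms] := leqP s m.
    have -> : (s - m = 0)%N by apply/eqP; rewrite subn_eq0.
    have -> : 0 - s%:R * (n - m)%N%:R / n%:R + m%:R * (n - m)%N%:R / n%:R =
      (n - m)%N%:R / n%:R * k :> R by rewrite (kE_le sm) (natrB _ sm); ring.
    by rewrite ler_wpM2r ?normr_ge0// ler_pdivlMr.
  have -> : (s - m)%N%:R - s%:R * (n - m)%N%:R / n%:R + m%:R * (n - m)%N%:R / n%:R =
      m%:R / n%:R * k :> R.
    by rewrite (kE_ge (ltnW ms)) (natrB _ (ltnW ms)) (natrB _ mlen); field.
  by rewrite ler_wpM2r ?normr_ge0// ler_pdivlMr.
have k0 : 0 <= k by exact: normr_ge0.
have kn : k <= n%:R.
  have [sm|ms] := leqP s m; first by rewrite (kE_le sm) ler_nat.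
  by rewrite (kE_ge (ltnW ms)) ler_nat.
have mu0 := min_shift_gt0 d0.
set dm := min_shift delta in mu0 *.
suff main : c ^+ 4 * dm ^+ 2 * k <= 16 * L ^+ 2.
  have -> : `|location n s - location n m : R| = k / n%:R.
    by rewrite /location -mulrBl normrM [X in _ * X]ger0_norm// invr_ge0.
  rewrite ler_pdivrMr//.
  have -> : 16 / c ^+ 4 * L ^+ 2 / (n%:R * dm ^+ 2) * n%:R =
      (16 * L ^+ 2) / (c ^+ 4 * dm ^+ 2).
    by field; rewrite nn0 !lt0r_neq0.
  rewrite ler_pdivlMr; first by rewrite mulrC.
  by rewrite mulr_gt0// exprn_gt0.
have sqn : Num.sqrt n%:R ^+ 2 = n%:R :> R by rewrite sqr_sqrtr// ltW.
have sqk : Num.sqrt k ^+ 2 = k by rewrite sqr_sqrtr.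
(* If the noise reaches the height of some peak, then [n * min_shift ^+ 2] is of
   order [L ^+ 2] and the trivial bound [k <= n] is enough. *)
have weak (del : R) : dm <= `|del| -> `|del| * - g m <= 4 * (Num.sqrt n%:R * L) ->
    c ^+ 4 * dm ^+ 2 * k <= 16 * L ^+ 2.
  move=> dmdel h.
  have h1 : c ^+ 2 * dm * n%:R <= 4 * (Num.sqrt n%:R * L).
    apply: le_trans h; rewrite mulrAC mulrC.
    by apply: ler_pM => //; rewrite ?(ltW mu0)// mulr_ge0// ?sqr_ge0// ltW.
  have h2 : (c ^+ 2 * dm * n%:R) ^+ 2 <= (4 * (Num.sqrt n%:R * L)) ^+ 2.
    by rewrite lerXn2r// nnegrE ?mulr_ge0 ?sqrtr_ge0 ?(ltW c0) ?(ltW mu0) ?(ltW n0).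
  have : n%:R * (c ^+ 4 * dm ^+ 2 * n%:R) <= n%:R * (16 * L ^+ 2).
    have -> : n%:R * (c ^+ 4 * dm ^+ 2 * n%:R) = (c ^+ 2 * dm * n%:R) ^+ 2 by ring.
    apply: le_trans h2 _; rewrite !exprMn sqn; lra.
  rewrite ler_pM2l// => h3; apply: le_trans h3.
  by rewrite ler_wpM2l// mulr_ge0// ?sqr_ge0// exprn_ge0// ltW.
have [j js] := row_norm_attained (cusum x s) p0.
have cmp l : `|cusum x m 0 l| <= `|cusum x s 0 j|.
  by rewrite -js (le_trans (coord_le_norm _ _))// smax.
(* When the coordinate [j] carries no signal, the noise in it dominates the peak
   of any coordinate [l] that carries some. *)
have [dj|dj] := eqVneq (delta 0 j) 0.
  have /existsNP[l /eqP dl] : ~ forall l, delta 0 l = 0.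
    move=> h; move/eqP: d0; apply; apply/rowP => l; rewrite h mxE//.
  apply: (weak (delta 0 l)); first exact: min_shift_le.
  have := cmp l; rewrite !zE// dj mul0r add0r => h.
  have : `|delta 0 l * g m| <= 2 * (Num.sqrt n%:R * L) + 2 * (Num.sqrt n%:R * L).
    rewrite -[delta 0 l * g m](addrK (bridge (fun i => e i 0 l) m)).
    rewrite (le_trans (ler_normB _ _))// lerD//.
      by rewrite (le_trans h)// W_le.
    by rewrite W_le.
  rewrite normrM (@ler0_norm _ (g m)) => [h'|]; first by lra.
  by rewrite -oppr_ge0 (le_trans _ gm_le)// mulr_ge0// ?sqr_ge0// ltW.
have := cmp j; rewrite !zE// => h.
have gmgs : g m <= g s by rewrite -subr_ge0 (le_trans _ g_incr)// mulr_ge0// ltW.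
have [h1|h1] := argmax_dichotomy gmgs gs_le0 h; last first.
  apply: (weak (delta 0 j)); first exact: min_shift_le.
  apply: le_trans h1 _.
  have -> : 4 * (Num.sqrt n%:R * L) = 2 * (Num.sqrt n%:R * L) + 2 * (Num.sqrt n%:R * L).
    by ring.
  by rewrite lerD// W_le.
have dmj := min_shift_le dj.
have h2 : dm * (c * k) <= 2 * (Num.sqrt k * L).
  apply: le_trans (W_incr j); apply: le_trans h1.
  by apply: ler_pM => //; rewrite ?(ltW mu0)// mulr_ge0// ltW.
have h3 : (dm * (c * k)) ^+ 2 <= (2 * (Num.sqrt k * L)) ^+ 2.
  by rewrite lerXn2r// nnegrE ?mulr_ge0 ?sqrtr_ge0 ?(ltW mu0) ?(ltW c0).
have [->|kn0] := eqVneq k 0; first by rewrite mulr0 mulr_ge0// sqr_ge0.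
have kgt0 : 0 < k by rewrite lt_def kn0.
have : k * (c ^+ 2 * dm ^+ 2 * k) <= k * (4 * L ^+ 2).
  have -> : k * (c ^+ 2 * dm ^+ 2 * k) = (dm * (c * k)) ^+ 2 by ring.
  apply: le_trans h3 _; rewrite !exprMn sqk; lra.
rewrite ler_pM2l// => h4.
have c2 : c ^+ 2 <= 1 by rewrite exprn_ile1// ltW.
have h5 : 0 <= c ^+ 2 * dm ^+ 2 * k by rewrite !mulr_ge0// ltW.
have -> : c ^+ 4 * dm ^+ 2 * k = c ^+ 2 * (c ^+ 2 * dm ^+ 2 * k) by ring.
have L2 := sqr_ge0 L.
apply: (@le_trans _ _ (c ^+ 2 * dm ^+ 2 * k)); first by rewrite ler_piMl.
by apply: le_trans h4 _; lra.
Qed.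

End localization.

(** * The location error with high probability *)

Section high_probability_bound.
Context d (T : measurableType d) (R : realType) (P : probability T R).

Lemma expR1_le4 : expR 1 <= 4 :> R.
Proof.
have h : expR (1 / 2) <= 2 :> R.
  have := expR_ge1Dx (- (1 / 2) : R); rewrite expRN.
  by rewrite -[leRHS]div1r ler_pdivlMr ?expR_gt0//; lra.
have -> : (1 : R) = 1 / 2 + 1 / 2 by lra.
by rewrite expRD; have := expR_gt0 (1 / 2 : R); nra.
Qed.

Lemma ln_np_ge1 (n p : nat) : (4 <= n)%N -> (3 <= p)%N -> 1 <= ln (n * p)%:R :> R.
Proof.
move=> n4 p3.
have np0 : 0 < (n * p)%:R :> R by rewrite ltr0n; nia.
rewrite -[leLHS]expRK ler_ln ?posrE ?expR_gt0//.
by rewrite (le_trans expR1_le4)// ler_nat; nia.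
Qed.

(** The argument of the logarithm is the inverse of the failure probability of one
    event, when [gamma / 2] is shared equally by the [2 * n.+1 ^ 2 * p] events of
    the union bound: a pair of endpoints, a coordinate and a sign. *)
Lemma log_count_le (n p : nat) (K gamma : R) : (4 <= n)%N -> (3 <= p)%N ->
  0 < gamma -> ln gamma^-1 <= K * ln (n * p)%:R ->
  ln ((4 * n.+1 ^ 2 * p)%N%:R / gamma) <= (4 + K) * ln (n * p)%:R.
Proof.
move=> n4 p3 g0 hK.
have np0 : 0 < (n * p)%:R :> R by rewrite ltr0n; nia.
rewrite lnM ?posrE ?invr_gt0// ?ltr0n; last by nia.
rewrite mulrDl lerD// mulr_natl -lnXn// ler_ln ?posrE ?exprn_gt0// ?ltr0n; last by nia.
rewrite -natrX ler_nat.
have h1 : (4 * n.+1 ^ 2 <= 16 * n ^ 2)%N by nia.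
have h3 : (16 * n ^ 2 * p <= (n * p) ^ 4)%N.
  have -> : ((n * p) ^ 4 = (n ^ 2 * p ^ 3) * (n ^ 2 * p))%N by lia.
  rewrite -mulnA leq_mul2r; apply/orP; right.
  by apply: (@leq_trans (4 ^ 2 * 3 ^ 3)%N) => //; rewrite leq_mul// leq_exp2r.
by apply: leq_trans h3; rewrite leq_mul2r h1 orbT.
Qed.

(** The noise level for [argmax_cusum_location] is [L = M * t], with [t] large
    enough for [concentration_index_sets] to fail with probability [gamma / 2] on
    the family of all intervals; the event [bad] takes the other half. *)
Lemma location_error_whp (n p : nat) (xi : 'I_n -> {RV P >-> p.-tuple R})
    (mu delta : 'rV[R]_p) (m : nat) (mhat : T -> nat) (gamma K c M A D : R)
    (tr : R -> R) (bad : set T) :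
  (4 <= n)%N -> (3 <= p)%N -> 0 < gamma < 1 ->
  ln gamma^-1 <= K * ln (n * p)%:R ->
  mutually_independent P (fun i => xi i : T -> p.-tuple R) ->
  delta != 0 -> (0 < m < n)%N -> 0 < c <= 1 ->
  c * n%:R <= m%:R -> c * n%:R <= (n - m)%N%:R ->
  measurable_fun setT mhat ->
  (forall w, is_argmax_cusum (mean_shift mu delta m xi w) (mhat w)) ->
  measurable_fun setT tr -> 0 < M -> 0 <= A ->
  (forall (i : 'I_n) (j : 'I_p) (eps : bool) (k : nat), (0 < k <= n)%N ->
    (\int[P]_w (expR ((-1) ^+ eps * tr (noise_coord xi i j w) / (M * Num.sqrt k%:R)))%:E
     <= (expR (A / k%:R))%:E)%E) ->
  measurable bad -> (P bad <= (gamma / 2)%:E)%E ->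
  (forall w, ~ bad w -> forall i j, tr (noise_coord xi i j w) = noise_coord xi i j w) ->
  16 / c ^+ 4 * (M * ((A + 4 + K) * ln (n * p)%:R)) ^+ 2
    / (n%:R * min_shift delta ^+ 2) <= D ->
  (P [set w | (`|location n (mhat w) - location n m| <= D)%R]
     >= (1 - gamma)%:E)%E.
Proof.
move=> n4 p3 /andP[g0 g1] hK indep d0 mn c01 cm cnm mmhat
  hargmax mtr M0 A0 mgf mbad Pbad trE leD.
set N := ln (n * p)%:R in hK leD *.
have N1 : 1 <= N by exact: ln_np_ge1.
pose Q : R := (4 * n.+1 ^ 2 * p)%N%:R / gamma.
have q0 : (0 < 4 * n.+1 ^ 2 * p)%N by rewrite !muln_gt0/=; exact: leq_trans p3.
have Q0 : 0 < Q by rewrite divr_gt0// ltr0n.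
pose t := A + ln Q.
have tN : t <= (A + 4 + K) * N.
  rewrite /t -addrA [leRHS]mulrDl lerD//; last exact: log_count_le.
  by rewrite ler_peMr.
have [G [mG PG HG]] := concentration_index_sets (@index_interval n) t
  indep mtr M0 A0 mgf mbad Pbad trE.
have PGg : (P (~` G) <= gamma%:E)%E.
  apply: (le_trans PG); rewrite lee_fin card_prod !card_ord.
  rewrite /t opprD addrA subrr sub0r expRN lnK ?posrE// /Q invf_div -(mulr_natr (gamma / _)).
  have nn0 : (n.+1)%:R != 0 :> R by rewrite pnatr_eq0.
  have pp0 : p%:R != 0 :> R by rewrite pnatr_eq0 -lt0n; exact: leq_trans p3.
  set r := (X in _ + X <= _).
  have -> : r = gamma / 2.
    rewrite /r !natrM; move: nn0 pp0; move: (n.+1)%:R p%:R => u v u0 v0.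
    by field; rewrite u0 v0.
  lra.
have PG1 : ((1 - gamma)%:E <= P G)%E.
  have := probability_setC P (measurableC mG); rewrite setCK => ->.
  by rewrite EFinB leeB.
set S := [set w | _].
have mS : measurable S.
  pose S' := [set s | `|location n s - location n m| <= D].
  have -> : S = setT `&` mhat @^-1` S' by rewrite setTI.
  by apply: mmhat.
apply: (le_trans PG1); apply: le_measure; rewrite ?inE//.
move=> w Gw; rewrite /S /=; apply: le_trans leD.
pose e (i : 'I_n) : 'rV[R]_p := vec_of (xi i w).
have xE i : mean_shift mu delta m xi w i =
    mu + (if (m < i.+1)%N then delta else 0) + e i by [].
have t0 : 0 <= t.
  rewrite addr_ge0// ln_ge0// ler_pdivlMr// mul1r (le_trans (ltW g1))//.
  by rewrite ler1n.
have He (j : 'I_p) (a b : nat) : (a <= b <= n)%N ->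
    `|\sum_(i in [set i : 'I_n | (a <= i < b)%N]%SET) e i 0 j|
      <= Num.sqrt (b - a)%N%:R * (M * t).
  move=> /andP[ab bn].
  have an : (a < n.+1)%N by rewrite ltnS (leq_trans ab).
  have bn' : (b < n.+1)%N by [].
  have := HG w Gw (Ordinal an, Ordinal bn') j.
  rewrite /index_interval/= card_interval// mulrAC mulrC.
  by rewrite (eq_bigr (fun i => e i 0 j))// => i _; rewrite /e /vec_of mxE.
have p0 : (0 < p)%N by exact: leq_trans p3.
apply: (le_trans (argmax_cusum_location p0 d0 c01 mn cm cnm xE He (hargmax w))).
have den0 : 0 <= (n%:R * min_shift delta ^+ 2)^-1 by rewrite invr_ge0 mulr_ge0 ?sqr_ge0.
have num0 : 0 <= 16 / c ^+ 4.
  by rewrite divr_ge0// exprn_ge0//; case/andP: c01 => /ltW.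
apply: (ler_wpM2r den0); apply: (ler_wpM2l num0).
have Mt0 : 0 <= M * t by rewrite mulr_ge0// ltW.
have MtN : M * t <= M * ((A + 4 + K) * N) by rewrite ler_wpM2l// ltW.
by rewrite lerXn2r// nnegrE (le_trans Mt0).
Qed.

End high_probability_bound.

(** * Moment generating functions under the two tail conditions *)

Section two_tail_conditions.
Context d (T : measurableType d) (R : realType) (P : probability T R).
Context (n p : nat) (xi : 'I_n -> {RV P >-> p.-tuple R}).

Lemma measurable_noise_coord i j : measurable_fun setT (noise_coord xi i j).
Proof.
apply: (@measurableT_comp _ _ _ _ _ _ (fun v : p.-tuple R => tnth v j)) => //.
exact: measurable_tnth.
Qed.

(** The scale [2 * b] lies strictly above the infimum that defines the norm, hence
    above some member of the set. *)
Lemma condC_exp_moment (b : R) i j : 0 < b -> condC xi b ->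
  (\int[P]_w (expR (`|noise_coord xi i j w| / (2 * b)))%:E <= 2%:E)%E.
Proof.
move=> b0 /(_ i j) psib.
have : (psi1_norm P (noise_coord xi i j) < (2 * b)%:E)%E.
  by apply: (le_lt_trans psib); rewrite lte_fin; lra.
move=> /ereal_inf_lt[_ [c [c0 +] <-]]; rewrite lte_fin unlock => Ec cb.
have mX := measurable_noise_coord i j.
have me (a : R) : measurable_fun setT (fun w => expR (`|noise_coord xi i j w| / a)).
  apply: measurableT_comp => //; apply: measurable_funM => //.
  exact: measurableT_comp.
apply: (@le_trans _ _ (\int[P]_w (1 + (expR (`|noise_coord xi i j w| / c) - 1)%:E))%E).
  apply: ge0_le_integral => //.
  - by apply/measurable_EFinP; exact: me.
  - apply: emeasurable_funD => //; apply/measurable_EFinP.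
    by apply: measurable_funB => //; exact: me.
  - move=> w _; rewrite -EFinD lee_fin addrC subrK ler_expR ler_wpM2l//.
    by rewrite lef_pV2 ?posrE ?mulr_gt0// ltW.
rewrite ge0_integralD//.
- have -> : (\int[P]_w (1 : \bar R) = 1)%E.
    by rewrite integral_cst// mul1e; exact: probability_setT.
  by have -> : 2%:E = (1 + 1)%E :> \bar R; [rewrite -EFinD|exact: leeD].
- by move=> w _; rewrite lee_fin subr_ge0 -expR0 ler_expR divr_ge0// ltW.
- apply/measurable_EFinP; apply: measurable_funB => //; exact: me.
Qed.

(** With [v = `|xi| / (4 * b)], the remainder of [expR_le_quadratic] is
    at most [4 * v ^+ 2 / k * expR v]; as [v ^+ 2 <= 4 * expR v], this is at most
    [16 / k * expR (2 * v)], whose expectation is bounded by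
    [condC_exp_moment]. *)
Lemma condC_mgf (b : R) i j (eps : bool) (k : nat) : 0 < b ->
  mean_zero xi -> condC xi b -> (0 < k)%N ->
  (\int[P]_w (expR ((-1) ^+ eps * noise_coord xi i j w
      / (4 * b * Num.sqrt k%:R)))%:E <= (expR (32 / k%:R))%:E)%E.
Proof.
move=> b0 mz hC k0; have [iX] := mz i j; rewrite unlock => X0.
have mX := measurable_noise_coord i j.
have kr0 : 0 < k%:R :> R by rewrite ltr0n.
set sk := Num.sqrt k%:R.
have sk1 : 1 <= sk by rewrite -sqrtr1 ler_wsqrtr// ler1n.
have sk0 : 0 < sk by exact: lt_le_trans sk1.
have bsk0 : 0 < 4 * b * sk by rewrite mulr_gt0// mulr_gt0.
have sk2 : sk ^+ 2 = k%:R by rewrite sqr_sqrtr// ltW.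
have -> : 32 / k%:R = 16 / k%:R * 2 :> R by field; exact: lt0r_neq0.
apply: (@mgf_le _ _ _ P (noise_coord xi i j)
  (fun w => expR (`|noise_coord xi i j w| / (2 * b))) _
  ((-1) ^+ eps / (4 * b * sk))) => //.
- apply: measurableT_comp => //; apply: measurable_funM => //.
  exact: measurableT_comp.
- exact: condC_exp_moment.
- apply: measurableT_comp => //; apply: measurable_funM => //.
  exact: measurable_funM.
move=> w; set X := noise_coord xi i j w.
set x := (-1) ^+ eps * X / (4 * b * sk).
apply: (le_trans (expR_le_quadratic x)).
have -> : (-1) ^+ eps / (4 * b * sk) * X = x by rewrite /x mulrAC.
rewrite lerD2l.
pose v := `|X| / (4 * b).
have v0 : 0 <= v by rewrite divr_ge0// mulr_ge0// ltW.
have xv : `|x| = v / sk.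
  rewrite /x normrM normfV (gtr0_norm bsk0) normrM normr_sign mul1r /v invfM.
  by rewrite mulrA.
have xlev : `|x| <= v by rewrite xv ler_pdivrMr ?sk0// ler_peMr.
have x2 : x ^+ 2 = v ^+ 2 / k%:R by rewrite -real_normK ?num_real// xv expr_div_n sk2.
have -> : `|X| / (2 * b) = v + v by rewrite /v; field; exact: lt0r_neq0.
have ev : v ^+ 2 <= 4 * expR v.
  have h : v / 2 <= expR (v / 2) by apply: le_trans (expR_ge1Dx _); lra.
  have -> : v = v / 2 + v / 2 by lra.
  rewrite expRD.
  have := ler_pM _ _ h h.
  have v20 : 0 <= v / 2 by lra.
  by move=> /(_ v20 v20); lra.
rewrite expRD x2.
have -> : 4 * (v ^+ 2 / k%:R) * expR `|x| = (4 * v ^+ 2 * expR `|x|) / k%:R by ring.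
have -> : 16 / k%:R * (expR v * expR v) = (16 * (expR v * expR v)) / k%:R by ring.
rewrite ler_pM2r ?invr_gt0//.
apply: (@le_trans _ _ (4 * (4 * expR v) * expR v)); last by lra.
apply: ler_pM.
- by rewrite mulr_ge0// sqr_ge0.
- exact: expR_ge0.
- by rewrite ler_pM2l.
- by rewrite ler_expR.
Qed.

Definition truncate (M y : R) : R := if `|y| <= M then y else 0.

Lemma measurable_truncate M : measurable_fun setT (truncate M).
Proof.
apply: measurable_fun_ifT => //; apply: measurable_fun_ler => //.
Qed.

Lemma measurable_bigmax (F : 'I_p -> T -> R) :
  (forall j, measurable_fun setT (F j)) ->
  measurable_fun setT (fun w => \big[Num.max/0]_(j < p) F j w).
Proof.
move=> mF; elim: (index_enum _) => [|j r IH].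
  by under eq_fun do rewrite big_nil; exact: measurable_cst.
by under eq_fun do rewrite big_cons; exact: measurable_maxr.
Qed.

Lemma measurable_noise_powR (b q : R) i j :
  measurable_fun setT (fun w => (`|noise_coord xi i j w| / b) `^ q).
Proof.
apply: (@measurableT_comp _ _ _ _ _ _ (fun x : R => x `^ q)).
  exact: measurable_powR.
apply: measurable_funM => //.
by apply: measurableT_comp => //; exact: measurable_noise_coord.
Qed.

Lemma condD_moment (b q : R) i j : condD xi b q ->
  (\int[P]_w ((`|noise_coord xi i j w| / b) `^ q)%:E <= 1)%E.
Proof.
move=> /(_ i); rewrite unlock; apply: le_trans; apply: ge0_le_integral => //.
- by move=> w _; rewrite lee_fin powR_ge0.
- by apply/measurable_EFinP; exact: measurable_noise_powR.
- by apply/measurable_EFinP; apply: measurable_bigmax => l; exact: measurable_noise_powR.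
move=> w _; rewrite lee_fin.
exact: (@le_bigmax _ _ _ 0 (fun j => (`|noise_coord xi i j w| / b) `^ q) j).
Qed.

(** Where the noise is at most [M], the remainder of [expR_le_quadratic] is bounded
    by [16 / k * (`|xi| / b) ^+ 2].  Where it exceeds [M], the truncation removes
    the linear term, which is at most [(`|xi| / M) `^ q / sqrt k]; this is at most
    [(`|xi| / b) `^ q / k] because [sqrt k <= n <= (M / b) `^ q]. *)
Lemma condD_mgf (b q M : R) i j (eps : bool) (k : nat) : 0 < b -> 2 <= q ->
  b <= M -> n%:R <= (M / b) `^ q ->
  mean_zero xi -> condD xi b q -> (0 < k <= n)%N ->
  (\int[P]_w (expR ((-1) ^+ eps * truncate M (noise_coord xi i j w)
      / (M * Num.sqrt k%:R)))%:E <= (expR (32 / k%:R))%:E)%E.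
Proof.
move=> b0 q2 bM nM mz hD /andP[k0 kn]; have [iX] := mz i j; rewrite unlock => X0.
have M0 : 0 < M by exact: lt_le_trans bM.
have mX := measurable_noise_coord i j.
have mr := measurable_noise_powR b q i j.
have kr0 : 0 < k%:R :> R by rewrite ltr0n.
set sk := Num.sqrt k%:R.
have sk1 : 1 <= sk by rewrite -sqrtr1 ler_wsqrtr// ler1n.
have sk0 : 0 < sk by exact: lt_le_trans sk1.
have Msk0 : 0 < M * sk by rewrite mulr_gt0.
have sk2 : sk ^+ 2 = k%:R by rewrite sqr_sqrtr// ltW.
have -> : 32 / k%:R = 16 / k%:R * 2 :> R by field; exact: lt0r_neq0.
apply: (@mgf_le _ _ _ P (noise_coord xi i j)
  (fun w => 1 + (`|noise_coord xi i j w| / b) `^ q) _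
  ((-1) ^+ eps / (M * sk))) => //.
- exact: measurable_funD.
- by move=> w; rewrite addr_ge0// powR_ge0.
- under eq_integral do rewrite EFinD.
  rewrite ge0_integralD//.
  + have -> : (\int[P]_w (1 : \bar R) = 1)%E.
      by rewrite integral_cst// mul1e; exact: probability_setT.
    have -> : 2%:E = (1 + 1)%E :> \bar R by rewrite -EFinD.
    by rewrite leeD2l// condD_moment.
  + by move=> w _; rewrite lee_fin powR_ge0.
  + exact/measurable_EFinP.
- apply: measurableT_comp => //; apply: measurable_funM => //.
  apply: measurable_funM => //; apply: measurableT_comp => //.
  exact: measurable_truncate.
move=> w; set X := noise_coord xi i j w.
have r0 : 0 <= `|X| / b by rewrite divr_ge0// ltW.
set r := (`|X| / b) `^ q.
have rq0 : 0 <= r by exact: powR_ge0.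
have lamE : (-1) ^+ eps / (M * sk) * X = (-1) ^+ eps * X / (M * sk) by rewrite mulrAC.
have normE : `|(-1) ^+ eps * X / (M * sk)| = `|X| / M / sk.
  by rewrite normrM normfV (gtr0_norm Msk0) normrM normr_sign mul1r invfM mulrA.
rewrite lamE; set x := (-1) ^+ eps * X / (M * sk) in normE *.
rewrite /truncate; have [XM|XM] := leP `|X| M.
  rewrite -/x; apply: (le_trans (expR_le_quadratic x)); rewrite lerD2l.
  have XM1 : `|X| / M <= 1 by rewrite ler_pdivrMr// mul1r.
  have x1 : `|x| <= 1.
    by rewrite normE ler_pdivrMr// mul1r (le_trans XM1).
  have x2 : x ^+ 2 = (`|X| / M) ^+ 2 / k%:R.
    by rewrite -real_normK ?num_real// normE expr_div_n sk2.
  have r2 : (`|X| / b) ^+ 2 <= 1 + r.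
    have [r1|r1] := leP (`|X| / b) 1.
      by rewrite (@le_trans _ _ 1) ?lerDl// exprn_ile1.
    rewrite -powR_mulrn// (@le_trans _ _ r)// ?lerDr//.
    by rewrite ler_powR// ltW.
  have XMb : (`|X| / M) ^+ 2 <= (`|X| / b) ^+ 2.
    rewrite lerXn2r// ?nnegrE//; first by rewrite divr_ge0// ltW.
    by rewrite ler_wpM2l// lef_pV2.
  have e4 : expR `|x| <= 4 by rewrite (le_trans _ (@expR1_le4 R))// ler_expR.
  rewrite x2.
  have -> : 4 * ((`|X| / M) ^+ 2 / k%:R) * expR `|x| =
     (4 * (`|X| / M) ^+ 2 * expR `|x|) / k%:R by ring.
  have -> : 16 / k%:R * (1 + r) = (4 * (1 + r) * 4) / k%:R by ring.
  rewrite ler_pM2r ?invr_gt0//; apply: ler_pM => //.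
  - by rewrite mulr_ge0// sqr_ge0.
  - by rewrite ler_pM2l// (le_trans XMb).
rewrite mulr0 mul0r expR0 -addrA lerDl.
suff h : `|x| <= 16 / k%:R * (1 + r).
  by have := ler_norm (- x); rewrite normrN; lra.
rewrite normE.
have XM1 : 1 <= `|X| / M by rewrite ler_pdivlMr// mul1r ltW.
have h1 : `|X| / M <= (`|X| / M) `^ q.
  rewrite -[leLHS]powRr1 ?divr_ge0 ?(ltW M0)// ler_powR//; lra.
have rE : r = (`|X| / M) `^ q * (M / b) `^ q.
  rewrite -powRM ?divr_ge0 ?(ltW M0) ?(ltW b0)//; congr (_ `^ q).
  by field; rewrite !lt0r_neq0.
have skk : sk <= n%:R.
  apply: (@le_trans _ _ k%:R); last by rewrite ler_nat.
  by rewrite -sk2 expr2 ler_peMr// ltW.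
have h2 : `|X| / M * sk <= r.
  rewrite rE; apply: ler_pM => //; rewrite ?(ltW sk0)//.
    by rewrite divr_ge0// ltW.
  exact: le_trans nM.
have -> : `|X| / M / sk = (`|X| / M * sk) / k%:R.
  by rewrite -sk2; field; rewrite !lt0r_neq0.
have -> : 16 / k%:R * (1 + r) = 16 * (1 + r) / k%:R by ring.
by rewrite ler_pM2r ?invr_gt0//; lra.
Qed.

Definition exceedance (b q s : R) : set T :=
  \bigcup_i [set w | s <= \big[Num.max/0]_(j < p) ((`|noise_coord xi i j w| / b) `^ q)].

Lemma measurable_exceedance b q s : measurable (exceedance b q s).
Proof.
apply: fin_bigcup_measurable => [|i _]; first exact: finite_finset.
rewrite -[X in measurable X]setTI; apply: measurable_fun_le => //.
by apply: measurable_bigmax => j; exact: measurable_noise_powR.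
Qed.

Lemma condD_exceedance (b q s : R) : 0 < s -> condD xi b q ->
  (P (exceedance b q s) <= (s^-1 *+ n)%:E)%E.
Proof.
move=> s0 hD; rewrite -[in X in (_ <= X)%E](card_ord n).
apply: union_bound => i.
  rewrite -[X in measurable X]setTI; apply: measurable_fun_le => //.
  by apply: measurable_bigmax => j; exact: measurable_noise_powR.
rewrite -[s^-1]div1r; apply: (@markov_ge0 _ _ _ P
  (fun w => \big[Num.max/0]_(j < p) ((`|noise_coord xi i j w| / b) `^ q))) => //.
- by apply: measurable_bigmax => j; exact: measurable_noise_powR.
- by move=> w; elim/big_ind: _ => // [x y x0 y0|j _]; rewrite ?le_max ?x0 ?powR_ge0.
- by have := hD i; rewrite unlock.
Qed.

Lemma truncate_off_exceedance (b q s M : R) : 0 < b -> 0 < q -> 0 <= M ->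
  s <= (M / b) `^ q -> forall w, ~ exceedance b q s w ->
  forall i j, truncate M (noise_coord xi i j w) = noise_coord xi i j w.
Proof.
move=> b0 q0 M0 sM w nE i j; rewrite /truncate; case: leP => // XM.
exfalso; apply: nE; exists i => //=.
apply: (le_trans sM).
apply: (@le_trans _ _ ((`|noise_coord xi i j w| / b) `^ q)).
  apply: ge0_ler_powR; rewrite ?nnegrE ?divr_ge0// ?(ltW b0)// ?(ltW q0)//.
  by rewrite ler_wpM2r ?invr_ge0// ltW.
exact: (@le_bigmax _ _ _ 0 (fun j => (`|noise_coord xi i j w| / b) `^ q) j).
Qed.

End two_tail_conditions.

Lemma location_margins (R : realType) (n m : nat) (c1 c2 : R) :
  (0 < n)%N -> (1 <= m <= n.-1)%N -> c1 <= location n m <= c2 ->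
  [/\ (0 < m < n)%N, Num.min c1 (1 - c2) * n%:R <= m%:R &
    Num.min c1 (1 - c2) * n%:R <= (n - m)%N%:R].
Proof.
move=> n0 mn; have mn' : (0 < m < n)%N by lia.
have mlen : (m <= n)%N by lia.
rewrite /location ler_pdivlMr ?ltr0n// ler_pdivrMr ?ltr0n//.
move=> /andP[h1 h2]; split=> //.
  by apply: le_trans h1; rewrite ler_wpM2r// ge_min lexx.
apply: (@le_trans _ _ ((1 - c2) * n%:R)).
  by rewrite ler_wpM2r// ge_min lexx orbT.
by rewrite natrB// mulrBl mul1r lerB.
Qed.

(** * Rate of the change point estimator *)

Theorem theorem3p5 (R : realType) (b K c1 c2 : R)
    (hb : 0 < b) (hK : 0 < K) (hc1 : 0 < c1 < 1) (hc2 : 0 < c2 < 1) :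
  (exists C : R, 0 < C /\
    forall (d : measure_display) (T : measurableType d) (P : probability T R)
      (n p : nat) (xi : 'I_n -> {RV P >-> p.-tuple R})
      (mu delta : 'rV[R]_p) (m : nat) (mhat : T -> nat) (gamma : R),
      (4 <= n)%N -> (3 <= p)%N ->
      iid xi -> mean_zero xi ->
      delta != 0 -> (1 <= m <= n.-1)%N ->
      measurable_fun setT mhat ->
      (forall w, is_argmax_cusum (mean_shift mu delta m xi w) (mhat w)) ->
      condB xi b ->
      c1 <= location n m <= c2 ->
      0 < gamma < expR (- 1) ->
      ln (n * p)%:R ^+ 3 <= K * n%:R ->
      ln gamma^-1 <= K * ln (n * p)%:R ->
      condC xi b ->
      (P [set w | (`|location n (mhat w) - location n m|
              <= C * ln (n * p)%:R ^+ 4 / (n%:R * min_shift delta ^+ 2))%R]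
        >= (1 - gamma)%:E)%E) /\
  (forall q : R, 2 <= q -> exists C : R, 0 < C /\
    forall (d : measure_display) (T : measurableType d) (P : probability T R)
      (n p : nat) (xi : 'I_n -> {RV P >-> p.-tuple R})
      (mu delta : 'rV[R]_p) (m : nat) (mhat : T -> nat) (gamma : R),
      (4 <= n)%N -> (3 <= p)%N ->
      iid xi -> mean_zero xi ->
      delta != 0 -> (1 <= m <= n.-1)%N ->
      measurable_fun setT mhat ->
      (forall w, is_argmax_cusum (mean_shift mu delta m xi w) (mhat w)) ->
      condB xi b ->
      c1 <= location n m <= c2 ->
      0 < gamma < expR (- 1) ->
      ln (n * p)%:R ^+ 3 <= K * n%:R ->
      ln gamma^-1 <= K * ln (n * p)%:R ->
      condD xi b q ->
      (P [set w | (`|location n (mhat w) - location n m|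
              <= C * ln (n * p)%:R / (n%:R * min_shift delta ^+ 2)
                 * Num.max 1 (n%:R `^ (2 / q) * ln (n * p)%:R
                              / gamma `^ (2 / q)))%R]
        >= (1 - gamma)%:E)%E).
Proof.
pose c := Num.min c1 (1 - c2).
have c01 : 0 < c <= 1.
  rewrite /c lt_min ge_min; case/andP: hc1 => -> /ltW -> /=.
  by rewrite andbT subr_gt0; case/andP: hc2.
have c0 : 0 < c by case/andP: c01.
pose B : R := 16 / c ^+ 4 * (32 + 4 + K) ^+ 2.
have B0 : 0 < B by rewrite !mulr_gt0 ?invr_gt0 ?exprn_gt0//; lra.
have expm1_lt1 : expR (- 1) < 1 :> R by rewrite expR_lt1; lra.
split=> [|q q2].
  exists (B * (4 * b) ^+ 2); split; first by rewrite mulr_gt0// exprn_gt0// mulr_gt0.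
  move=> d T P n p xi mu delta m mhat gamma n4 p3 [indep _] mz d0 mn mmhat hargmax
    _ tm /andP[g0 g1] _ hK' hC.
  have [mn' cm cnm] := location_margins (leq_trans (isT : (0 < 4)%N) n4) mn tm.
  have N1 := @ln_np_ge1 R _ _ n4 p3.
  set N := ln (n * p)%:R in hK' N1 *.
  apply: (@location_error_whp _ _ _ P n p xi mu delta m mhat gamma K c (4 * b) 32
    _ id set0) => //.
  - by rewrite g0 (lt_trans g1).
  - by rewrite mulr_gt0.
  - by move=> i j eps k /andP[k0 _]; exact: condC_mgf.
  - by rewrite measure0 lee_fin divr_ge0// ltW.
  have den0 : 0 <= (n%:R * min_shift delta ^+ 2)^-1.
    by rewrite invr_ge0 mulr_ge0// sqr_ge0.
  apply: (ler_wpM2r den0).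
  have -> : 16 / c ^+ 4 * (4 * b * ((32 + 4 + K) * N)) ^+ 2 =
    B * (4 * b) ^+ 2 * N ^+ 2 by rewrite /B; ring.
  have Bb0 : 0 <= B * (4 * b) ^+ 2 by apply: mulr_ge0; [exact: ltW|exact: sqr_ge0].
  by apply: (ler_wpM2l Bb0); rewrite ler_weXn2l.
have q0 : 0 < q by lra.
exists (B * (b ^+ 2 * 2 `^ (2 / q))); split.
  by rewrite mulr_gt0// mulr_gt0 ?exprn_gt0 ?powR_gt0.
move=> d T P n p xi mu delta m mhat gamma n4 p3 [indep _] mz d0 mn mmhat hargmax
  _ tm /andP[g0 g1] _ hK' hD.
have [mn' cm cnm] := location_margins (leq_trans (isT : (0 < 4)%N) n4) mn tm.
have N1 := @ln_np_ge1 R _ _ n4 p3.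
set N := ln (n * p)%:R in hK' N1 *.
have gl1 : gamma < 1 by exact: lt_trans g1 _.
have n0 : 0 < n%:R :> R by rewrite ltr0n; exact: leq_trans n4.
(* The truncation level is exceeded with probability at most [n / s]. *)
pose s : R := 2 * (n%:R / gamma).
have ns : n%:R <= s.
  rewrite /s mulrA ler_pdivlMr//.
  by rewrite mulrC ler_wpM2r ?(ltW n0)//; lra.
have s1 : 1 <= s by apply: le_trans ns; rewrite ler1n; exact: leq_trans n4.
have s0 : 0 < s by exact: lt_le_trans s1.
pose M := b * s `^ q^-1.
have M0 : 0 < M by rewrite mulr_gt0// powR_gt0.
have Mb : (M / b) `^ q = s.
  by rewrite /M mulrAC divff ?mul1r ?lt0r_neq0// -powRrM mulVf ?powRr1 ?lt0r_neq0// ltW.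
have bM : b <= M.
  by rewrite ler_peMr ?(ltW hb)// -(powRr0 s) ler_powR// invr_ge0 ltW.
have M2 : M ^+ 2 = b ^+ 2 * 2 `^ (2 / q) * (n%:R `^ (2 / q) / gamma `^ (2 / q)).
  rewrite /M exprMn -(powR_mulrn 2 (powR_ge0 s q^-1)) -powRrM [q^-1 * _]mulrC /s.
  rewrite !powRM ?mulr_ge0 ?invr_ge0 ?(ltW n0) ?(ltW g0)//.
  by rewrite -(powR_inv1 (ltW g0)) -powRrM mulN1r powRN; ring.
apply: (@location_error_whp _ _ _ P n p xi mu delta m mhat gamma K c M 32
  _ (truncate M) (exceedance xi b q s)) => //.
- by rewrite g0.
- exact: measurable_truncate.
- by move=> i j eps k kn; apply: (condD_mgf (b := b) (q := q)) => //; rewrite Mb.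
- exact: measurable_exceedance.
- apply: (le_trans (condD_exceedance s0 hD)); rewrite lee_fin -mulr_natr /s.
  rewrite le_eqVlt; apply/orP; left; apply/eqP.
  by field; rewrite !lt0r_neq0.
- by apply: (truncate_off_exceedance hb q0 (ltW M0)); rewrite Mb.
have den0 : 0 <= (n%:R * min_shift delta ^+ 2)^-1.
  by rewrite invr_ge0 mulr_ge0// sqr_ge0.
rewrite [leRHS]mulrAC; apply: (ler_wpM2r den0).
have -> : 16 / c ^+ 4 * (M * ((32 + 4 + K) * N)) ^+ 2 =
    B * (b ^+ 2 * 2 `^ (2 / q)) * N * (n%:R `^ (2 / q) * N / gamma `^ (2 / q)).
  have -> : 16 / c ^+ 4 * (M * ((32 + 4 + K) * N)) ^+ 2 = B * M ^+ 2 * N ^+ 2.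
    by rewrite /B; ring.
  by rewrite M2; ring.
have Bb0 : 0 <= B * (b ^+ 2 * 2 `^ (2 / q)) * N.
  apply: mulr_ge0; last exact: le_trans N1.
  by apply: mulr_ge0; [exact: ltW|apply: mulr_ge0; [exact: sqr_ge0|exact: powR_ge0]].
by apply: (ler_wpM2l Bb0); rewrite le_max lexx orbT.
Qed.
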